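(* Let $\mathcal{L}$ be the syntax category. For any $x,y\in\mathcal{L}$ and every $c\in\mathcal{L}$, $$[h^x,h^y](c)=\inf_{d\in\mathcal{L}}\ \min\left\{\frac{\pi(d|y)}{\min\{\pi(d|c),\pi(d|x)\}},\,1\right\}.$$
   Context: The unit interval $[0,1]$ is a commutative monoidal preorder under $\le$ and multiplication, with internal hom $[a,b]:=b/a$ if $b<a$ and $[a,b]:=1$ otherwise; thus $[a,b]=\min\{b/a,1\}$ with the convention that $b/0\ge1$ for all $0\le b\le1$ (so a term with zero denominator contributes $1$). A $[0,1]$-category $\mathcal{C}$ is a set of objects with numbers $\mathcal{C}(x,y)\in[0,1]$ such that $\mathcal{C}(x,x)=1$ and $\mathcal{C}(y,z)\mathcal{C}(x,y)\le\mathcal{C}(x,z)$ for all $x,y,z$. A $[0,1]$-copresheaf on $\mathcal{C}$ is a function $f\colon\mathcal{C}\to[0,1]$ with $\mathcal{C}(x,y)\le[fx,fy]$ for all $x,y$. The $[0,1]$-category of copresheaves $\widehat{\mathcal{C}}$ has hom objects $\widehat{\mathcal{C}}(f,g)=\inf_{c\in\mathcal{C}}[fc,gc]$. The syntax category $\mathcal{L}$ is the $[0,1]$-category whose objects are the expressions (texts) of a language and whose hom objects are $\mathcal{L}(x,y):=\pi(y|x)\in[0,1]$, the probability that $y$ extends $x$, where $\pi(y|x)=0$ if $x$ is not a subtext of $y$; being a $[0,1]$-category means $\pi(x|x)=1$ and $\pi(z|y)\pi(y|x)\le\pi(z|x)$ for all $x,y,z$. For $x\in\mathcal{L}$, the representable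 copresheaf is $h^x:=\mathcal{L}(x,-)$, i.e. $h^x(c)=\pi(c|x)$. For copresheaves $f,g$ on $\mathcal{L}$, $f\times g$ is the copresheaf $(f\times g)(c)=\min\{fc,gc\}$ (the weighted product with both weights equal to $1$), and $[f,g]\colon\mathcal{L}\to[0,1]$ is defined by $[f,g](c):=\widehat{\mathcal{L}}(h^c\times f,g)$. *)

(* Defs.v *)
From HB Require Import structures.
From mathcomp Require Import all_boot all_order all_algebra.
From mathcomp Require Import boolp classical_sets reals.

Set Implicit Arguments.
Unset Strict Implicit.
Unset Printing Implicit Defensive.
Import Order.TTheory GRing.Theory Num.Theory.
Local Open Scope classical_set_scope.
Local Open Scope ring_scope.

Definition ihom (R : realType) (a b : R) : R := if b < a then b / a else 1.

(* The quotient b / a with the convention that b / 0 is at least 1 for b in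
   [0, 1]; only its minimum with 1 is ever used, so the value 1 is immaterial.
   (In MathComp b / 0 = 0, which would be the wrong convention.) *)
Definition quot (R : realType) (b a : R) : R := if a == 0 then 1 else b / a.

(* Infimum in the complete lattice [0, 1]: adding the top element 1 changes
   nothing for nonempty subsets of [0, 1], and gives inf set0 = 1, whereas the
   infimum of set0 in a realType is 0 by convention. *)
Definition inf01 (R : realType) (S : set R) : R := inf (1 |` S).

Section unit_interval.
Variable R : realType.
Implicit Types (a b c : R) (S : set R).

Lemma ihom_ge0 a b : 0 <= b -> 0 <= ihom a b.
Proof.
move=> b0; rewrite /ihom; case: ifPn => // ba.
by rewrite divr_ge0 // ltW // (le_lt_trans b0).
Qed.

Lemma ihom_le1 a b : 0 <= b -> ihom a b <= 1.
Proof.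
move=> b0; rewrite /ihom; case: ifPn => // ba.
by rewrite ler_pdivrMr ?mul1r ?ltW // (le_lt_trans b0).
Qed.

Lemma ihom_id a : ihom a a = 1.
Proof. by rewrite /ihom ltxx. Qed.

Lemma ihom_adj a b c : 0 <= b -> 0 <= c -> a <= 1 ->
  (a <= ihom b c) = (a * b <= c).
Proof.
move=> b0 c0 a1; rewrite /ihom; case: ifPn => [cb|].
  by rewrite ler_pdivlMr // (le_lt_trans c0).
by rewrite -leNgt => bc; rewrite a1 (le_trans _ bc) // ler_piMl.
Qed.

Lemma ihom_comp a b c : 0 <= a -> 0 <= b -> 0 <= c ->
  ihom b c * ihom a b <= ihom a c.
Proof.
move=> a0 b0 c0; rewrite ihom_adj ?mulr_ile1 ?ihom_ge0 ?ihom_le1 //.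
rewrite -mulrA (@le_trans _ _ (ihom b c * b)) //.
  by rewrite ler_wpM2l ?ihom_ge0 // -ihom_adj ?ihom_le1.
by rewrite -ihom_adj ?ihom_le1.
Qed.

Lemma le_inf01 S a : a <= 1 -> (forall s, S s -> a <= s) -> a <= inf01 S.
Proof.
move=> a1 aS; apply: lb_le_inf; first by exists 1; left.
by move=> s [->//|/aS].
Qed.

Lemma inf01_le S s : (forall t, S t -> 0 <= t) -> S s -> inf01 S <= s.
Proof.
move=> S0 Ss; apply: ge_inf; last by right.
by exists 0 => t [->|/S0].
Qed.

Lemma inf01_ge0 S : (forall t, S t -> 0 <= t) -> 0 <= inf01 S.
Proof. by move=> S0; exact: le_inf01. Qed.

Lemma inf01_le1 S : (forall t, S t -> 0 <= t) -> inf01 S <= 1.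
Proof.
move=> S0; apply: ge_inf; last by left.
by exists 0 => t [->|/S0].
Qed.

End unit_interval.

Record cat01 (R : realType) := Cat01 {
  obj :> Type;
  hom : obj -> obj -> R;
  hom_ge0 : forall x y, 0 <= hom x y;
  hom_le1 : forall x y, hom x y <= 1;
  hom_id : forall x, hom x x = 1;
  hom_comp : forall x y z, hom y z * hom x y <= hom x z }.

Record copresheaf (R : realType) (C : cat01 R) := Copresheaf {
  cop_fun :> C -> R;
  cop_ge0 : forall x, 0 <= cop_fun x;
  cop_le1 : forall x, cop_fun x <= 1;
  cop_hom : forall x y, hom x y <= ihom (cop_fun x) (cop_fun y) }.

Section copresheaves.
Variables (R : realType) (C : cat01 R).
Implicit Types (f g h : copresheaf C) (x : C).

Definition cop_homval f g : R := inf01 [set ihom (f c) (g c) | c in [set: C]].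

Let ihom_vals_ge0 f g t : [set ihom (f c) (g c) | c in [set: C]] t -> 0 <= t.
Proof. by move=> [c _ <-]; exact/ihom_ge0/cop_ge0. Qed.

Fact cop_homval_ge0 f g : 0 <= cop_homval f g.
Proof. exact/inf01_ge0/ihom_vals_ge0. Qed.

Fact cop_homval_le1 f g : cop_homval f g <= 1.
Proof. exact/inf01_le1/ihom_vals_ge0. Qed.

Fact cop_homval_id f : cop_homval f f = 1.
Proof.
apply/eqP; rewrite eq_le cop_homval_le1 /=; apply: le_inf01 => // s [c _ <-].
by rewrite ihom_id.
Qed.

Fact cop_homval_comp f g h :
  cop_homval g h * cop_homval f g <= cop_homval f h.
Proof.
apply: le_inf01 => [|s [c _ <-]].
  by rewrite mulr_ile1 ?cop_homval_ge0 ?cop_homval_le1.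
apply: le_trans (ihom_comp (cop_ge0 f c) (cop_ge0 g c) (cop_ge0 h c)).
by apply: ler_pM; rewrite ?cop_homval_ge0 //;
  apply: inf01_le (@ihom_vals_ge0 _ _) _; exists c.
Qed.

Definition copresheaves : cat01 R :=
  Cat01 cop_homval_ge0 cop_homval_le1 cop_homval_id cop_homval_comp.

Fact representable_hom x (c d : C) : hom c d <= ihom (hom x c) (hom x d).
Proof. by rewrite ihom_adj ?hom_ge0 ?hom_le1 ?hom_comp. Qed.

Definition representable x : copresheaf C :=
  Copresheaf (@hom_ge0 _ _ x) (@hom_le1 _ _ x) (representable_hom x).

Definition cop_prod_fun f g (c : C) : R := Num.min (f c) (g c).

Fact cop_prod_ge0 f g c : 0 <= cop_prod_fun f g c.
Proof. by rewrite /cop_prod_fun le_min !cop_ge0. Qed.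

Fact cop_prod_le1 f g c : cop_prod_fun f g c <= 1.
Proof. by rewrite /cop_prod_fun ge_min cop_le1. Qed.

Fact cop_prod_hom f g c d :
  hom c d <= ihom (cop_prod_fun f g c) (cop_prod_fun f g d).
Proof.
rewrite ihom_adj ?cop_prod_ge0 ?hom_le1 // [leRHS]/cop_prod_fun le_min.
apply/andP; split.
  have := cop_hom f c d; rewrite ihom_adj ?cop_ge0 ?hom_le1 //.
  by apply: le_trans; rewrite ler_wpM2l ?hom_ge0 // ge_min lexx.
have := cop_hom g c d; rewrite ihom_adj ?cop_ge0 ?hom_le1 //.
by apply: le_trans; rewrite ler_wpM2l ?hom_ge0 // ge_min lexx orbT.
Qed.

Definition cop_prod f g : copresheaf C :=
  Copresheaf (@cop_prod_ge0 f g) (@cop_prod_le1 f g) (@cop_prod_hom f g).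

Definition cop_exp f g (c : C) : R :=
  @hom R copresheaves (cop_prod (representable c) f) g.

End copresheaves.

(* [prob y x] is the probability pi(y | x) that the text y extends the text x;
   note the order of the arguments. The relation [subtext x y] ("x is a subtext
   of y") is left arbitrary. *)
Record syntax_data (R : realType) := SyntaxData {
  text : Type;
  subtext : text -> text -> Prop;
  prob : text -> text -> R;
  prob_ge0 : forall x y, 0 <= prob y x;
  prob_le1 : forall x y, prob y x <= 1;
  prob_not_subtext : forall x y, ~ subtext x y -> prob y x = 0;
  prob_id : forall x, prob x x = 1;
  prob_comp : forall x y z, prob z y * prob y x <= prob z x }.

Definition syntax_category (R : realType) (L : syntax_data R) : cat01 R :=
  @Cat01 R (text L) (fun x y => prob y x)
    (@prob_ge0 R L) (@prob_le1 R L) (@prob_id R L) (@prob_comp R L).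

Coercion syntax_category : syntax_data >-> cat01.

(* Main.v *)
Require Import Defs.
From HB Require Import structures.
From mathcomp Require Import all_boot all_order all_algebra.
From mathcomp Require Import boolp classical_sets reals.

Set Implicit Arguments.
Unset Strict Implicit.
Unset Printing Implicit Defensive.
Import Order.TTheory GRing.Theory Num.Theory.
Local Open Scope classical_set_scope.
Local Open Scope ring_scope.

(** Unfolding the exponential already gives an infimum over [d] of [ihom] values, with the pointwise
    minimum of two representables as first argument. Only two conventions are left to reconcile:
    [ihom] with a truncated quotient ([ihomE]), and the infimum in the lattice [0, 1] with the real
    one ([inf01E]). *)

(** At [a = 0] both sides are 1, as no [b >= 0] lies below 0. For [a > 0], [b < a] amounts to
    [b / a < 1], so both sides split in the same way. *)
Lemma ihomE (R : realType) (a b : R) : 0 <= a -> 0 <= b ->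
  ihom a b = Num.min (quot b a) 1.
Proof.
rewrite /ihom /quot le_eqVlt eq_sym; have [->|_ /= a0] := eqVneq a 0.
  by move=> _ b0; rewrite ltNge b0 minxx.
move=> b0; case: ltP => ba; apply/esym.
  by apply: min_l; rewrite ler_pdivrMr // mul1r ltW.
by apply: min_r; rewrite ler_pdivlMr // mul1r.
Qed.

(** The adjoined 1 lies above every element of [S], so it cannot lower the infimum once [S] has an
    element. *)
Lemma inf01E (R : realType) (S : set R) :
  S !=set0 -> S `<=` `[0, 1] -> inf01 S = inf S.
Proof.
move=> [s Ss] S01.
have S_ge0 t : S t -> 0 <= t by move/S01; rewrite /= in_itv => /andP[].
have S_le1 t : S t -> t <= 1 by move/S01; rewrite /= in_itv => /andP[].
have infS t : S t -> inf S <= t by move=> St; apply: ge_inf => //; exists 0.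
apply/eqP; rewrite eq_le; apply/andP; split.
  by apply: lb_le_inf => [|t]; [exists s | exact: inf01_le].
by apply: le_inf01 => //; apply: le_trans (infS _ Ss) (S_le1 _ Ss).
Qed.

Theorem theorem4 (R : realType) (L : syntax_data R) (x y c : L) :
  cop_exp (representable x) (representable y) c =
  inf [set Num.min (quot (prob d y) (Num.min (prob d c) (prob d x))) 1
      | d in [set: L]].
Proof.
rewrite /cop_exp /= /cop_homval inf01E.
- congr inf; apply: eq_imagel => d _.
  by rewrite ihomE ?cop_ge0.
(* The texts are inhabited by [c] itself, so its own term serves as witness. *)
- by exists (ihom (cop_prod (representable c) (representable x) c)
                  (representable y c)), c.
- move=> _ [d _ <-] /=.
  by rewrite in_itv /= ihom_ge0 ?ihom_le1 ?prob_ge0.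
Qed.
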